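(* Consider a system $\dot x=f(x)u+g(x)w$, $y=[h_1(x),\dots,h_p(x)]$ (known input $u$, unknown input $w$), with $f,g$ smooth vector fields and $h_1,\dots,h_p$ smooth functions on an $n$-dimensional manifold $\mathcal M$, which is in canonical form with respect to its unknown input: some output $h\in\{h_1,\dots,h_p\}$ satisfies $\mathcal L_g h\neq0$; fix such an $h$. Let $\mathcal O$ and $\Omega_k$ ($k\ge0$) be the codistributions defined in the context. Then there exists $\hat k$ such that, for any $k\ge\hat k$, $\mathcal O\subseteq\Omega_k$. Conversely, for any $k$, $\Omega_k\subseteq\mathcal O$.
   Context: **Conventions.** $\nabla$ is the differential with respect to $x$; $\mathcal L_f$ is the Lie derivative along $f$ (on scalars $\mathcal L_fh=\nabla h\cdot f$; on covector fields the usual one, so $\mathcal L_f\nabla h=\nabla\mathcal L_fh$). A (co)distribution is the span, over the ring of smooth functions on the open set under consideration, of finitely many (co)vector fields; for a codistribution $\Omega$, $\mathcal L_f\Omega$ is the span of all $\mathcal L_f\omega$, $\omega\in\Omega$. $[g,\phi]=\frac{\partial\phi}{\partial x}g-\frac{\partial g}{\partial x}\phi$. One works on an open set where $L^1_g:=\mathcal L_gh$ does not vanish. **Definitions.** $\widehat g=g/L^1_g$. Autobracket of a vector field $\phi$: $[\phi]=\frac{[g,\phi]}{L^1_g}$; $[\phi]^{(0)}=\phi$, $[\phi]^{(m+1)}=[[\phi]^{(m)}]$. Integer $s$: smallest integer with $\Omega^g_s=\Omega^g_{s-1}$, where $\Omega^g_0=\mathrm{span}\{\nabla h\}$, $\Omega^g_k=\Omega^g_{k-1}+\mathcal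 L_g\Omega^g_{k-1}$ (so $s\le n$). Integer $r$: smallest integer with $\Delta_{r+1}=\Delta_r$, where $\Delta_0=\mathrm{span}\{f\}$, $\Delta_k=\Delta_{k-1}+\mathrm{span}\{[v]:v\in\Delta_{k-1}\}$ (so $r\le n-1$); $f,[f],\dots,[f]^{(r)}$ is a basis of $\Delta:=\Delta_r$. Codistribution $\widetilde{\mathcal O}=\sum_{j=0}^{s+r}\mathrm{span}\{\nabla\mathcal L_{[f]^{(j)}}h\}$. Codistribution $\mathcal O$: $\mathcal O_0=\widetilde{\mathcal O}+\mathrm{span}\{\nabla h_1,\dots,\nabla h_p\}$, $\mathcal O_{k+1}=\mathcal O_k+\mathcal L_f\mathcal O_k+\mathcal L_{\widehat g}\mathcal O_k$, and $\mathcal O=\mathcal O_k$ at the smallest $k$ with $\mathcal O_k=\mathcal O_{k-1}$ (this $k$ is at most $n$). Codistributions $\Omega_k$: $\Omega_0=\mathrm{span}\{\nabla h_1,\dots,\nabla h_p\}$, $\Omega_{k+1}=\Omega_k+\mathcal L_f\Omega_k+\mathcal L_{\widehat g}\Omega_k+\mathrm{span}\{\mathcal L_{[f]^{(k)}}\nabla h\}$. The recursions are taken to terminate as stated. *)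

(* Defs.v *)
From HB Require Import structures.
From mathcomp Require Import all_boot all_order all_algebra.
From mathcomp Require Import all_classical all_reals all_analysis.
Import Order.TTheory GRing.Theory Num.Theory.
Import numFieldNormedType.Exports.

Set Implicit Arguments.
Unset Strict Implicit.
Unset Printing Implicit Defensive.

Local Open Scope classical_set_scope.
Local Open Scope ring_scope.

Definition partial (R : realType) (n : nat) (l : 'I_n) (F : 'rV[R]_n -> R) :
    'rV[R]_n -> R :=
  fun x => 'D_(delta_mx 0 l) F x.

(* [diff_upto k V F]: F and all its iterated partial derivatives of order at
   most k are (Frechet) differentiable at every point of V. *)
Fixpoint diff_upto (R : realType) (n k : nat) (V : set 'rV[R]_n)
    (F : 'rV[R]_n -> R) {struct k} : Prop :=
  (forall x, V x -> differentiable F x) /\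
  match k with
  | 0 => True
  | k'.+1 => forall l : 'I_n, diff_upto k' V (partial l F)
  end.

(* C^oo on V; only used for V open, where the values of F outside V are
   irrelevant. *)
Definition smooth_on (R : realType) (n : nat) (V : set 'rV[R]_n)
    (F : 'rV[R]_n -> R) : Prop :=
  forall k, diff_upto k V F.

Record chart (R : realType) (n : nat) (T : topologicalType) := Chart {
  cdom : set T;
  cmap : T -> 'rV[R]_n;
  cinv : 'rV[R]_n -> T;
  cdom_open : open cdom;
  cimg_open : open (cmap @` cdom);
  cmapK : forall p, cdom p -> cinv (cmap p) = p;
  cmap_continuous : forall p, cdom p -> {for p, continuous cmap};
  cinv_continuous : forall x, (cmap @` cdom) x -> {for x, continuous cinv}
}.

Record smooth_manifold (R : realType) (n : nat) := SmoothManifold {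
  points :> topologicalType;
  points_hausdorff : hausdorff_space points;
  points_second_countable : @second_countable points;
  atlas_index : Type;
  atlas : atlas_index -> chart R n points;
  atlas_cover : forall p : points, exists i, cdom (atlas i) p;
  atlas_compat : forall (i j : atlas_index) (l : 'I_n),
    smooth_on (cmap (atlas i) @` (cdom (atlas i) `&` cdom (atlas j)))
              (fun x => cmap (atlas j) (cinv (atlas i) x) 0 l)
}.

Section Fields.
Variables (R : realType) (n : nat) (M : smooth_manifold R n).

Definition smooth_fun (U : set M) (a : M -> R) : Prop :=
  forall i : atlas_index M,
    smooth_on (cmap (atlas i) @` (U `&` cdom (atlas i))) (a \o cinv (atlas i)).

(* A (co)vector field is given by its components in every chart of the atlas:
   [X i p 0 l] is the l-th component at p in the chart i, meaningful only for
   p in the domain of that chart. *)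
Definition tfield : Type := atlas_index M -> M -> 'rV[R]_n.

(* l-th partial derivative at p, in the coordinates x of the chart i *)
Definition dx (i : atlas_index M) (l : 'I_n) (a : M -> R) (p : M) : R :=
  partial l (a \o cinv (atlas i)) (cmap (atlas i) p).

Definition is_vector_field (U : set M) (X : tfield) : Prop :=
  (forall (i : atlas_index M) (l : 'I_n),
     smooth_on (cmap (atlas i) @` (U `&` cdom (atlas i)))
               (fun x => X i (cinv (atlas i) x) 0 l)) /\
  (forall (i j : atlas_index M) (p : M),
     U p -> cdom (atlas i) p -> cdom (atlas j) p -> forall l : 'I_n,
     X j p 0 l =
     \sum_(m < n) dx i m (fun q => cmap (atlas j) q 0 l) p * X i p 0 m).

Definition chart_at (p : M) : atlas_index M := projT1 (cid (atlas_cover p)).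

(* The value does not depend on the chart when X is a vector field and a is
   smooth. *)
Definition lie_fun (X : tfield) (a : M -> R) : M -> R :=
  fun p => \sum_(l < n) dx (chart_at p) l a p * X (chart_at p) p 0 l.

Definition nabla (a : M -> R) : tfield := fun i p => \row_l dx i l a p.

Definition lie_covector (X w : tfield) : tfield := fun i p =>
  \row_l (\sum_(m < n) (X i p 0 m * dx i m (fun q => w i q 0 l) p
                        + w i p 0 m * dx i l (fun q => X i q 0 m) p)).

Definition bracket (X Y : tfield) : tfield := fun i p =>
  \row_l (\sum_(m < n) (dx i m (fun q => Y i q 0 l) p * X i p 0 m
                        - dx i m (fun q => X i q 0 l) p * Y i p 0 m)).

Definition field_add (v w : tfield) : tfield := fun i p => v i p + w i p.

Definition field_scale (a : M -> R) (v : tfield) : tfield :=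
  fun i p => a p *: v i p.

Definition eq_field_on (U : set M) (v w : tfield) : Prop :=
  forall i p, U p -> cdom (atlas i) p -> v i p = w i p.

(* Span over the ring of smooth functions on U.  A field on U is represented by
   a [tfield] with arbitrary values off U, so the spans, and all (co)distributions
   below, are saturated for [eq_field_on U]. *)
Definition fspan (U : set M) (S : set tfield) : set tfield :=
  [set w | exists (m : nat) (a : 'I_m -> M -> R) (v : 'I_m -> tfield),
     (forall j, smooth_fun U (a j) /\ S (v j)) /\
     eq_field_on U w (fun i p => \sum_(j < m) field_scale (a j) (v j) i p)].

Definition dsum (U : set M) (A B : set tfield) : set tfield :=
  [set w | exists v1 v2, A v1 /\ B v2 /\ eq_field_on U w (field_add v1 v2)].

Definition lie_codistr (U : set M) (X : tfield) (Om : set tfield) : set tfield :=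
  fspan U (lie_covector X @` Om).

End Fields.

Definition smallest (P : nat -> Prop) (m : nat) : Prop :=
  P m /\ forall k, P k -> (m <= k)%N.

Section System.
Variables (R : realType) (n : nat) (M : smooth_manifold R n).
Variables (U : set M) (f g : tfield M) (p : nat) (hs : 'I_p -> M -> R).
Variable h : M -> R.

Definition ghat : tfield M := field_scale (fun q => (lie_fun g h q)^-1) g.

Definition autobracket (phi : tfield M) : tfield M :=
  field_scale (fun q => (lie_fun g h q)^-1) (bracket g phi).

Definition autobracket_iter (m : nat) (phi : tfield M) : tfield M :=
  iter m autobracket phi.

Fixpoint Omega_g (k : nat) : set (tfield M) :=
  match k with
  | 0 => fspan U [set nabla h]
  | k'.+1 => dsum U (Omega_g k') (lie_codistr U g (Omega_g k'))
  end.

(* k >= 1, as Omega_g (k - 1) has to make sense (and k.-1 = k for k = 0) *)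
Definition is_s : nat -> Prop :=
  smallest (fun k => (0 < k)%N /\ Omega_g k = Omega_g k.-1).

Fixpoint Delta (k : nat) : set (tfield M) :=
  match k with
  | 0 => fspan U [set f]
  | k'.+1 => dsum U (Delta k') (fspan U (autobracket @` Delta k'))
  end.

Definition is_r : nat -> Prop := smallest (fun k => Delta k.+1 = Delta k).

Definition O_tilde (s r : nat) : set (tfield M) :=
  \big[dsum U / fspan U set0]_(0 <= j < (s + r).+1)
     fspan U [set nabla (lie_fun (autobracket_iter j f) h)].

Definition output_codistr : set (tfield M) :=
  fspan U [set nabla (hs j) | j in [set: 'I_p]].

Fixpoint O_seq (s r k : nat) : set (tfield M) :=
  match k with
  | 0 => dsum U (O_tilde s r) output_codistr
  | k'.+1 =>
      dsum U (dsum U (O_seq s r k') (lie_codistr U f (O_seq s r k')))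
             (lie_codistr U ghat (O_seq s r k'))
  end.

(* The codistribution O is [O_seq s r K] for the K such that [is_O_index s r K]. *)
Definition is_O_index (s r : nat) : nat -> Prop :=
  smallest (fun k => (0 < k)%N /\ O_seq s r k = O_seq s r k.-1).

Fixpoint Omega (k : nat) : set (tfield M) :=
  match k with
  | 0 => output_codistr
  | k'.+1 =>
      dsum U
        (dsum U (dsum U (Omega k') (lie_codistr U f (Omega k')))
                (lie_codistr U ghat (Omega k')))
        (fspan U [set lie_covector (autobracket_iter k' f) (nabla h)])
  end.

End System.

(* Main.v *)
(** Write [phi_j] for the [j]-th autobracket of [f], [L] for [L_g h], and let
    [w_0 = dh], [w_{i+1} = L^-1 L_g w_i].  The functions
    [chi i j = <w_i, phi_j>] satisfy [ghat (chi i j) = chi i.+1 j + chi i j.+1].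
    The functions whose differential lies in [O] are stable under [ghat], so,
    starting from [chi 0 j = L_{phi_j} h] for [j <= s + r], all [chi i j] with
    [i + j <= s + r] have their differential in [O].  Beyond that antidiagonal,
    by the choice of [s] and [r], [w_s = sum_k a_k w_{i_k}] with [i_k < s] and
    [phi_j = sum_l b_l phi_{j_l}] with [j_l <= r].  The differentials of the
    coefficients need not lie in [O], but they cancel in
    [d(chi s j) = sum_l b_l d(chi s j_l) + sum_k a_k d(chi i_k j)
                  - sum_{k,l} a_k b_l d(chi i_k j_l)],
    which puts one entry of each further antidiagonal in [O]; the recursion
    gives the others.  In particular [O] contains the differential of every
    [L_{phi_j} h], hence every [Omega_k]. *)

Require Import Defs.
From mathcomp Require Import all_boot all_order all_algebra.
From mathcomp Require Import all_classical all_reals all_analysis.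
From mathcomp Require Import ring zify.
Import Order.TTheory GRing.Theory Num.Theory.
Import numFieldNormedType.Exports.
Local Open Scope classical_set_scope.
Local Open Scope ring_scope.

Set Implicit Arguments.
Unset Strict Implicit.

(** * Smooth functions on open subsets of R^n *)

(** The first-order expansion of [f] at [x] is also one of [g], since the two agree near [x].
    Differentiability is thus local, as needed for functions controlled only on an open set. *)
Lemma near_eq_differentiable (R : numFieldType) (V W : normedModType R)
    (f g : V -> W) (x : V) :
  {near x, f =1 g} -> differentiable f x -> differentiable g x.
Proof.
move=> fg df.
have fgx : f x = g x by exact: nbhs_singleton fg.
have cdf : continuous ('d f x) by exact: diff_continuous.
have E : g \o shift x = cst (g x) + 'd f x +o_ 0 id.
  apply/eqaddoP => e e0.
  have /eqaddoP/(_ e e0) := diff_locally df.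
  have fg0 : \forall h \near (0 : V), f (h + x) = g (h + x).
    by move: fg; rewrite (near_shift 0 x) /= subr0.
  rewrite fgx; apply: filterS2 fg0 => h /= Eh.
  by rewrite !fctE /= Eh.
by apply/diff_locallyP; rewrite (diff_unique cdf E).
Qed.

Lemma is_derive_line (R : realType) (V : normedModType R) (F : V -> R)
    (y u : V) (s : R) : differentiable F (y + s *: u) ->
  is_derive s 1 (fun t => F (y + t *: u)) ('D_u F (y + s *: u)).
Proof.
move=> dF.
pose l := fun t : R => y + t *: u.
have dl : is_diff s l ( *:%R^~ u).
  have := @is_diffD R R V (cst y) ( *:%R^~ u) 0 ( *:%R^~ u) s _ _.
  rewrite add0r; exact.
have cl : differentiable (F \o l) s by apply: differentiable_comp.
apply: DeriveDef; first exact/derivable1_diffP.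
rewrite -[LHS]/('D_1 (F \o l) s) deriveE// diff_comp//= [X in _ X = _](_ : _ = u).
  by rewrite deriveE.
by rewrite (@diff_val _ _ _ _ _ _ _ dl) scale1r.
Qed.

(** Two applications of the mean value theorem: first along [u], to the difference of [F] on two
    parallel segments, then along [v], to ['D_u F]. *)
Lemma second_difference (R : realType) (V : normedModType R) (F : V -> R)
    (x u v : V) (t : R) : 0 < t ->
  (forall a b, a \in `[0, t] -> b \in `[0, t] ->
     differentiable F (x + a *: u + b *: v) /\
     differentiable ('D_u F) (x + a *: u + b *: v)) ->
  exists a b, [/\ a \in `[0, t], b \in `[0, t] &
    F (x + t *: u + t *: v) - F (x + t *: u) - F (x + t *: v) + F x =
    'D_v ('D_u F) (x + a *: u + b *: v) * t * t].
Proof.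
move=> t0 dF.
have i0 : 0 \in `[0, t] by rewrite in_itv /= lexx ltW.
have it : t \in `[0, t] by rewrite in_itv /= lexx ltW.
pose P s := F (x + t *: v + s *: u) - F (x + s *: u).
pose dP s := 'D_u F (x + t *: v + s *: u) - 'D_u F (x + s *: u).
have HP s : s \in `[0, t] -> is_derive s 1 P (dP s).
  move=> si; have [d1 _] := dF _ _ si it; have [d0 _] := dF _ _ si i0.
  apply: is_deriveB; apply: is_derive_line; first by rewrite addrAC.
  by move: d0; rewrite scale0r addr0.
have sub : {subset `]0, t[ <= `[0, t]} by move=> z; exact: subset_itv_oo_cc.
have cP : {within `[0, t], continuous P}.
  by apply: derivable_within_continuous => z /HP [].
have [a ia Ea] := MVT t0 (fun z zi => HP z (sub z zi)) cP.
have ia' := sub _ ia.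
pose Q s := 'D_u F (x + a *: u + s *: v).
have HQ s : s \in `[0, t] -> is_derive s 1 Q ('D_v ('D_u F) (x + a *: u + s *: v)).
  by move=> si; apply: is_derive_line; have [] := dF _ _ ia' si.
have cQ : {within `[0, t], continuous Q}.
  by apply: derivable_within_continuous => z /HQ [].
have [b ib Eb] := MVT t0 (fun z zi => HQ z (sub z zi)) cQ.
exists a, b; split => //; first exact: sub.
move: Ea Eb; rewrite /P /dP /Q !scale0r !addr0 !subr0 [x + t *: v + a *: u]addrAC
  [x + t *: v + t *: u]addrAC => + Eb.
rewrite Eb => <-; ring.
Qed.

Lemma continuous_pair_ball (R : realType) (V : normedModType R) (G H : V -> R)
    (A : set V) (x : V) (e : R) : open A -> A x ->
  {for x, continuous G} -> {for x, continuous H} -> 0 < e ->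
  exists2 d, 0 < d & forall y, ball x d y ->
    [/\ A y, `|G x - G y| < e & `|H x - H y| < e].
Proof.
move=> oA Ax cG cH e0.
have : \forall y \near x, [/\ A y, `|G x - G y| < e & `|H x - H y| < e].
  near=> y; split; near: y.
  - exact: open_nbhs_nbhs.
  - by move/cvgrPdist_lt : cG; exact.
  - by move/cvgrPdist_lt : cH; exact.
by move/nbhs_ballP => [d /= d0 Hd]; exists d.
Unshelve. all: by end_near. Qed.

Lemma dist_le_of_close (R : realFieldType) (p p' q q' t e : R) :
  (t == 0) = false -> `|p - p'| < e / 2 -> `|q - q'| < e / 2 ->
  p' * t * t = q' * t * t -> `|p - q| <= e.
Proof.
move=> /negbT t0 Hp Hq /(mulIf t0)/(mulIf t0) E.
rewrite -(subrKA p') (le_trans (ler_normD _ _))// [e]splitr {2}E (distrC q').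
by rewrite lerD// ltW.
Qed.

(** Schwarz's theorem. The second difference is symmetric in [u] and [v]; divided by the square of
    [t] it is a value of either mixed derivative at points as close to [x] as desired, and both are
    continuous at [x]. *)
Lemma derive_comm (R : realType) (V : normedModType R) (F : V -> R) (A : set V)
    (x u v : V) : open A -> A x ->
  (forall y, A y -> differentiable F y) ->
  (forall y, A y -> differentiable ('D_u F) y) ->
  (forall y, A y -> differentiable ('D_v F) y) ->
  {for x, continuous ('D_v ('D_u F))} -> {for x, continuous ('D_u ('D_v F))} ->
  'D_v ('D_u F) x = 'D_u ('D_v F) x.
Proof.
move=> oA Ax dF duF dvF cvu cuv.
apply/eqP; rewrite -subr_eq0 -normr_le0; apply/ler_addgt0Pl => e e0.
rewrite addr0.
have e2 : 0 < e / 2 by rewrite divr_gt0.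
have [d d0 Hd] := continuous_pair_ball oA Ax cvu cuv e2.
(* The summand 1 keeps [c] positive even when [u] and [v] vanish. Since [t * c] is half of [d], the
   whole parallelogram of second differences stays in the ball of radius [d]. *)
pose c := `|u| + `|v| + 1.
have c0 : 0 < c by rewrite ltr_wpDl// addr_ge0.
pose t := d / c / 2.
have t0 : 0 < t by rewrite !divr_gt0.
have Hb a b : a \in `[0, t] -> b \in `[0, t] -> ball x d (x + a *: u + b *: v).
  rewrite !in_itv /= => /andP[a0 at_] /andP[b0 bt].
  rewrite -ball_normE /= -addrA opprD addNKr normrN.
  apply: le_lt_trans (ler_normD _ _) _; rewrite !normrZ !ger0_norm//.
  have : a * `|u| + b * `|v| <= t * c.
    rewrite /c !mulrDr mulr1 -[leLHS]addr0; apply: lerD; last exact: ltW.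
    by apply: lerD; apply: ler_wpM2r.
  move/le_lt_trans; apply.
  by rewrite /t mulrAC divfK ?gt_eqF// ltr_pdivrMr// ltr_pMr// ltr1n.
have [a [b [ia ib E1]]] : exists a b, [/\ a \in `[0, t], b \in `[0, t] &
    F (x + t *: u + t *: v) - F (x + t *: u) - F (x + t *: v) + F x =
    'D_v ('D_u F) (x + a *: u + b *: v) * t * t].
  apply: second_difference => // a b ia ib.
  by have [Ay _ _] := Hd _ (Hb _ _ ia ib); split; [exact: dF|exact: duF].
have [b' [a' [ib' ia' E2]]] : exists b a, [/\ b \in `[0, t], a \in `[0, t] &
    F (x + t *: v + t *: u) - F (x + t *: v) - F (x + t *: u) + F x =
    'D_u ('D_v F) (x + b *: v + a *: u) * t * t].
  apply: second_difference => // b1 a1 ib1 ia1; rewrite addrAC.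
  by have [Ay _ _] := Hd _ (Hb _ _ ia1 ib1); split; [exact: dF|exact: dvF].
have [_ B1 _] := Hd _ (Hb _ _ ia ib).
have [_ _ B2] := Hd _ (Hb _ _ ia' ib').
rewrite addrAC in B2.
apply: (dist_le_of_close (gt_eqF t0) B1 B2 (etrans (esym E1) (etrans _ E2))).
by rewrite [x + t *: v + _]addrAC [_ - F (x + t *: v)]addrAC.
Qed.

(** * Closure properties of smooth functions of several variables *)

Section SmoothOn.
Variables (R : realType) (n : nat).
Implicit Types (V W : set 'rV[R]_n) (F G : 'rV[R]_n -> R) (k : nat) (l : 'I_n).

Lemma partial_ext V F G l x : open V -> V x -> (forall y, V y -> F y = G y) ->
  partial l F x = partial l G x.
Proof.
by move=> oV Vx FG; apply: near_eq_derive; near=> y; apply: FG; near: y;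
  exact: open_nbhs_nbhs.
Unshelve. all: by end_near. Qed.

Lemma diff_upto_differentiable k V F : diff_upto k V F ->
  forall x, V x -> differentiable F x.
Proof. by case: k => [|k] []. Qed.

Lemma diff_uptoW k V F : diff_upto k.+1 V F -> diff_upto k V F.
Proof.
elim: k F => [|k IH] F [dF pF]; first by split.
by split=> // l; apply: IH; exact: pF.
Qed.

Lemma diff_upto_sub k V W F : V `<=` W -> diff_upto k W F -> diff_upto k V F.
Proof.
move=> VW; elim: k F => [|k IH] F [dF pF]; split=> //.
- by move=> x /VW; exact: dF.
- by move=> x /VW; exact: dF.
- by move=> l; apply: IH; exact: pF.
Qed.

Lemma diff_upto_ext k V F G : open V -> (forall x, V x -> F x = G x) ->
  diff_upto k V F -> diff_upto k V G.
Proof.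
move=> oV; elim: k F G => [|k IH] F G FG [dF pF].
  split=> // x Vx; apply: near_eq_differentiable (dF x Vx).
  by near=> y; apply: FG; near: y; exact: open_nbhs_nbhs.
split.
  move=> x Vx; apply: near_eq_differentiable (dF x Vx).
  by near=> y; apply: FG; near: y; exact: open_nbhs_nbhs.
by move=> l; apply: IH (pF l) => x Vx; exact: partial_ext FG.
Unshelve. all: by end_near. Qed.

Lemma partialD F G l x : differentiable F x -> differentiable G x ->
  partial l (F \+ G) x = partial l F x + partial l G x.
Proof. by move=> dF dG; apply: deriveD; exact: diff_derivable. Qed.

Lemma partialM F G l x : differentiable F x -> differentiable G x ->
  partial l (F \* G) x = F x * partial l G x + G x * partial l F x.
Proof. by move=> dF dG; apply: deriveM; exact: diff_derivable. Qed.

Lemma partial_cst (c : R) l x : partial l (cst c) x = 0.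
Proof. exact: derive_cst. Qed.

Lemma diff_upto_cst k V (c : R) : diff_upto k V (cst c).
Proof.
elim: k c => [|k IH] c; split=> //; try by move=> *; exact: differentiable_cst.
move=> l; rewrite (_ : partial l _ = cst 0)//.
by apply/funext => x; rewrite partial_cst.
Qed.

Lemma diff_uptoD k V F G : open V -> diff_upto k V F -> diff_upto k V G ->
  diff_upto k V (F \+ G).
Proof.
move=> oV; elim: k F G => [|k IH] F G [dF pF] [dG pG].
  by split=> // x Vx; apply: differentiableD; [exact: dF|exact: dG].
split=> [x Vx|l]; first by apply: differentiableD; [exact: dF|exact: dG].
apply: (diff_upto_ext (F := partial l F \+ partial l G)) => //.
  by move=> x Vx; rewrite partialD//; [exact: dF|exact: dG].
by apply: IH; [exact: pF|exact: pG].
Qed.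

Lemma diff_uptoM k V F G : open V -> diff_upto k V F -> diff_upto k V G ->
  diff_upto k V (F \* G).
Proof.
move=> oV; elim: k F G => [|k IH] F G.
  move=> [dF _] [dG _]; split=> // x Vx.
  by apply: differentiableM; [exact: dF|exact: dG].
move=> F1 G1; have [dF pF] := F1; have [dG pG] := G1.
split=> [x Vx|l]; first by apply: differentiableM; [exact: dF|exact: dG].
apply: (diff_upto_ext (F := F \* partial l G \+ G \* partial l F)) => //.
  by move=> x Vx; rewrite partialM//; [exact: dF|exact: dG].
by apply: diff_uptoD => //; apply: IH => //;
  by [exact: diff_uptoW|exact: pF|exact: pG].
Qed.

Lemma partialV F l x : differentiable F x -> F x != 0 ->
  partial l (fun y => (F y)^-1) x = - ((F x)^-1 * (F x)^-1 * partial l F x).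
Proof.
move=> dF F0; rewrite /partial deriveV//; last exact: diff_derivable.
by rewrite -[_ *: _]/(_ * _) mulNr expr2 invfM.
Qed.

(** A partial derivative of the inverse of [F] is minus the squared inverse times that of [F], so
    the induction hypothesis on the inverse itself and the product rule give the next order. *)
Lemma diff_uptoV k V F : open V -> (forall x, V x -> F x != 0) ->
  diff_upto k V F -> diff_upto k V (fun y => (F y)^-1).
Proof.
move=> oV F0; elim: k => [|k IH].
  by move=> [dF _]; split=> // x Vx; apply: differentiableV; [exact: dF|exact: F0].
move=> F1; have [dF pF] := F1.
split=> [x Vx|l]; first by apply: differentiableV; [exact: dF|exact: F0].
have Hi := IH (diff_uptoW F1).
apply: (diff_upto_ext (F := cst (-1) \*
  ((fun y => (F y)^-1) \* (fun y => (F y)^-1) \* partial l F))) => //.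
  by move=> x Vx; rewrite partialV//= ?mulN1r//; [exact: dF|exact: F0].
apply: diff_uptoM => //; first exact: diff_upto_cst.
by do 2?apply: diff_uptoM => //; exact: pF.
Qed.

Lemma smooth_on_differentiable V F x : smooth_on V F -> V x ->
  differentiable F x.
Proof. by move=> sF Vx; exact: diff_upto_differentiable (sF 0%N) x Vx. Qed.

Lemma smooth_on_partial V F l : smooth_on V F -> smooth_on V (partial l F).
Proof. by move=> sF k; have [_] := sF k.+1; exact. Qed.

Lemma partialC V F l m x : open V -> smooth_on V F -> V x ->
  partial l (partial m F) x = partial m (partial l F) x.
Proof.
move=> oV sF Vx.
have dp (j : 'I_n) y : V y -> differentiable (partial j F) y.
  by move=> Vy; apply: smooth_on_differentiable Vy; exact: smooth_on_partial.
apply: (derive_comm oV Vx) => //; try exact: dp.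
- by move=> y Vy; exact: smooth_on_differentiable Vy.
- apply: differentiable_continuous; apply: smooth_on_differentiable Vx.
  by do 2 apply: smooth_on_partial.
- apply: differentiable_continuous; apply: smooth_on_differentiable Vx.
  by do 2 apply: smooth_on_partial.
Qed.

(** Chain rule in coordinates: [t] is the sum of its components times the basis vectors, so its
    differentiability and its differential are read off componentwise. *)
Lemma partial_comp m (F : 'rV[R]_m -> R) (t : 'rV[R]_n -> 'rV[R]_m) l x :
  (forall j, differentiable (fun y => t y 0 j) x) -> differentiable F (t x) ->
  partial l (F \o t) x =
    \sum_(j < m) partial j F (t x) * partial l (fun y => t y 0 j) x.
Proof.
move=> dt dF.
have tE : t = \sum_(j < m) (fun y => t y 0 j *: (delta_mx 0 j : 'rV[R]_m)).
  apply/funext => y; rewrite fct_sumE [LHS]row_sum_delta.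
  by apply: eq_bigr.
have dt' : differentiable t x.
  by rewrite tE; apply: differentiable_sum => j; exact: differentiableZl.
have dc : differentiable (F \o t) x by exact: differentiable_comp.
rewrite /partial deriveE// diff_comp//=.
have -> : 'd t x (delta_mx 0 l) = \sum_(j < m)
    partial l (fun y => t y 0 j) x *: (delta_mx 0 j : 'rV[R]_m).
  rewrite -deriveE// {1}tE derive_sum; last first.
    by move=> j; apply: diff_derivable; exact: differentiableZl.
  apply: eq_bigr => j _; rewrite deriveE; last exact: differentiableZl.
  by rewrite diffZl// /partial deriveE.
rewrite linear_sum; apply: eq_bigr => j _.
by rewrite linearZ /= -[_ *: _]/(_ * _) mulrC /partial [in RHS]deriveE.
Qed.

End SmoothOn.

(** * Calculus in charts *)

Section ChartCalculus.
Variables (R : realType) (n : nat) (M : smooth_manifold R n).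
Implicit Types (U W : set M) (a b : M -> R) (X Y w : tfield M)
  (i j : atlas_index M) (l m : 'I_n) (p q : M).

(** Smoothness seen from a single chart: a component of a field belongs to one chart and has no
    meaning off its domain, so [smooth_fun] does not apply to it. *)
Definition smooth_in i W a : Prop :=
  smooth_on (cmap (atlas i) @` (W `&` cdom (atlas i))) (a \o cinv (atlas i)).

(** Near the image of a point, the set contains the part of the open image of the chart that the
    inverse, continuous there, sends into [W]. *)
Lemma chart_image_open i W : open W ->
  open (cmap (atlas i) @` (W `&` cdom (atlas i))).
Proof.
move=> oW; rewrite openE => _ [p [Wp ip] <-]; rewrite /interior.
have imp : (cmap (atlas i) @` cdom (atlas i)) (cmap (atlas i) p) by exists p.
have n1 : nbhs (cmap (atlas i) p) (cmap (atlas i) @` cdom (atlas i)).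
  by apply: open_nbhs_nbhs; split=> //; exact: cimg_open.
have n2 : nbhs (cmap (atlas i) p) (cinv (atlas i) @^-1` W).
  apply: (cinv_continuous imp); rewrite cmapK//.
  exact: open_nbhs_nbhs.
apply: filterS2 n1 n2 => _ [q iq <-] /=; rewrite cmapK// => Wq.
by exists q.
Qed.

Lemma smooth_in_sub i W U a : W `<=` U -> smooth_in i U a -> smooth_in i W a.
Proof.
by move=> WU sa k; apply: diff_upto_sub (sa k); apply: image_subset; apply: setSI.
Qed.

Lemma smooth_in_cst i W (c : R) : smooth_in i W (cst c).
Proof. by move=> k; exact: diff_upto_cst. Qed.

Section OpenSet.
Variables (i : atlas_index M) (W : set M).
Hypothesis oW : open W.

Let oI := @chart_image_open i W oW.

Lemma smooth_in_ext a b : (forall q, W q -> cdom (atlas i) q -> a q = b q) ->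
  smooth_in i W a -> smooth_in i W b.
Proof.
move=> ab sa k; apply: diff_upto_ext oI _ (sa k) => _ [q [Wq iq] <-] /=.
by rewrite cmapK// ab.
Qed.

Lemma smooth_inD a b : smooth_in i W a -> smooth_in i W b ->
  smooth_in i W (fun q => a q + b q).
Proof. by move=> sa sb k; exact: diff_uptoD oI (sa k) (sb k). Qed.

Lemma smooth_inM a b : smooth_in i W a -> smooth_in i W b ->
  smooth_in i W (fun q => a q * b q).
Proof. by move=> sa sb k; exact: diff_uptoM oI (sa k) (sb k). Qed.

Lemma smooth_inN a : smooth_in i W a -> smooth_in i W (fun q => - a q).
Proof.
move=> sa; apply: smooth_in_ext (smooth_inM (smooth_in_cst i W (-1)) sa).
by move=> q _ _ /=; rewrite mulN1r.
Qed.

Lemma smooth_inV a : (forall q, W q -> a q != 0) -> smooth_in i W a ->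
  smooth_in i W (fun q => (a q)^-1).
Proof.
move=> a0 sa k; apply: (diff_uptoV oI) (sa k) => _ [q [Wq iq] <-] /=.
by rewrite cmapK// a0.
Qed.

Lemma smooth_in_sum (k : nat) (F : 'I_k -> M -> R) :
  (forall e, smooth_in i W (F e)) -> smooth_in i W (fun q => \sum_(e < k) F e q).
Proof.
elim: k F => [|k IH] F sF.
  by apply: smooth_in_ext (smooth_in_cst i W 0) => q _ _; rewrite big_ord0.
have H := smooth_inD (IH (fun e => F (widen_ord (leqnSn k) e)) (fun e => sF _))
  (sF ord_max).
by apply: smooth_in_ext H => q _ _; rewrite big_ord_recr.
Qed.

Lemma smooth_in_dx l a : smooth_in i W a -> smooth_in i W (dx i l a).
Proof.
move=> sa k; have := smooth_on_partial l sa k.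
apply: diff_upto_ext oI _ => _ [q [Wq iq] <-] /=.
by rewrite /dx cmapK.
Qed.

Section Point.
Variable p : M.
Hypotheses (Wp : W p) (ip : cdom (atlas i) p).

Let Ip : (cmap (atlas i) @` (W `&` cdom (atlas i))) (cmap (atlas i) p).
Proof. by exists p. Qed.

Lemma smooth_in_differentiable a : smooth_in i W a ->
  differentiable (a \o cinv (atlas i)) (cmap (atlas i) p).
Proof. by move=> sa; exact: smooth_on_differentiable sa Ip. Qed.

Lemma dx_ext l a b : (forall q, W q -> cdom (atlas i) q -> a q = b q) ->
  dx i l a p = dx i l b p.
Proof.
move=> ab; apply: partial_ext oI Ip _ => _ [q [Wq iq] <-] /=.
by rewrite cmapK// ab.
Qed.

Lemma dxD l a b : smooth_in i W a -> smooth_in i W b ->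
  dx i l (fun q => a q + b q) p = dx i l a p + dx i l b p.
Proof.
by move=> sa sb; apply: partialD; exact: smooth_in_differentiable.
Qed.

Lemma dxM l a b : smooth_in i W a -> smooth_in i W b ->
  dx i l (fun q => a q * b q) p = a p * dx i l b p + b p * dx i l a p.
Proof.
move=> sa sb; rewrite [LHS]partialM; try exact: smooth_in_differentiable.
by rewrite /= cmapK.
Qed.

Lemma dx_cst l (c : R) : dx i l (cst c) p = 0.
Proof. exact: partial_cst. Qed.

Lemma dxB l a b : smooth_in i W a -> smooth_in i W b ->
  dx i l (fun q => a q - b q) p = dx i l a p - dx i l b p.
Proof.
move=> sa sb; rewrite dxD//; last exact: smooth_inN.
congr (_ + _); transitivity (dx i l (fun q => (cst (-1) q : R) * b q) p).
  by apply: dx_ext => q _ _; rewrite /= mulN1r.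
rewrite dxM//; last exact: smooth_in_cst.
by rewrite dx_cst mulr0 addr0 mulN1r.
Qed.

Lemma dx_sum l (k : nat) (F : 'I_k -> M -> R) :
  (forall e, smooth_in i W (F e)) ->
  dx i l (fun q => \sum_(e < k) F e q) p = \sum_(e < k) dx i l (F e) p.
Proof.
elim: k F => [|k IH] F sF.
  rewrite big_ord0 -[RHS](dx_cst l 0).
  by apply: dx_ext => q _ _; rewrite big_ord0.
rewrite big_ord_recr /= -IH// -dxD//; last exact: smooth_in_sum.
by apply: dx_ext => q _ _; rewrite big_ord_recr.
Qed.

Lemma dxC l m a : smooth_in i W a ->
  dx i l (dx i m a) p = dx i m (dx i l a) p.
Proof.
move=> sa.
have E l1 m1 : dx i l1 (dx i m1 a) p =
    partial l1 (partial m1 (a \o cinv (atlas i))) (cmap (atlas i) p).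
  apply: partial_ext oI Ip _ => _ [q [Wq iq] <-] /=.
  by rewrite /dx cmapK.
by rewrite !E; exact: partialC oI sa Ip.
Qed.

(** Chain rule for the transition map [t]: on the overlap of the two charts, [b] read in chart [i]
    is [b] read in chart [j] composed with [t]. *)
Lemma dx_change_chart j m b : cdom (atlas j) p -> smooth_in j W b ->
  dx i m b p =
  \sum_(l < n) dx j l b p * dx i m (fun q => cmap (atlas j) q 0 l) p.
Proof.
move=> jp sb.
pose t := cmap (atlas j) \o cinv (atlas i).
have tE : t (cmap (atlas i) p) = cmap (atlas j) p by rewrite /t /= cmapK.
pose V := cmap (atlas i) @` (cdom (atlas j) `&` cdom (atlas i)).
have oV : open V by apply: chart_image_open; exact: cdom_open.
have Vp : V (cmap (atlas i) p) by exists p.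
transitivity (partial m ((b \o cinv (atlas j)) \o t) (cmap (atlas i) p)).
  apply: partial_ext oV Vp _ => _ [q [jq iq] <-] /=.
  by rewrite /t /= !cmapK.
rewrite partial_comp.
- by apply: eq_bigr => l _; rewrite tE.
- move=> l; apply: (smooth_on_differentiable (V := V)) => //.
  by rewrite /V setIC; exact: atlas_compat.
- rewrite tE; apply: (smooth_on_differentiable sb).
  by exists p.
Qed.

End Point.
End OpenSet.

(** The chart remains explicit because [w] is an arbitrary family of components, for instance a Lie
    derivative, for which no transformation law is established. *)
Definition pairing i w X p : R := \sum_(l < n) w i p 0 l * X i p 0 l.

Definition smooth_components U w : Prop :=
  forall i l, smooth_in i U (fun q => w i q 0 l).

Lemma lie_fun_chart_at X a p :
  lie_fun X a p = pairing (chart_at p) (nabla a) X p.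
Proof. by apply: eq_bigr => l _; rewrite mxE. Qed.

Lemma cdom_chart_at p : cdom (atlas (chart_at p)) p.
Proof. by rewrite /chart_at; case: cid. Qed.

Lemma is_vector_field_sub U W X : W `<=` U -> is_vector_field U X ->
  is_vector_field W X.
Proof.
move=> WU [sX tX]; split=> [i l|i j p Wp]; last exact/tX/WU.
exact: (smooth_in_sub (a := fun q => X i q 0 l) WU (sX i l)).
Qed.

Lemma vector_field_components U X : is_vector_field U X -> smooth_components U X.
Proof. by case. Qed.

(** * Lie derivatives and brackets on an open set *)

Section OpenSetFields.
Variable U : set M.
Hypothesis oU : open U.

(** The chain rule for [a] and the transformation law of [X] involve the same Jacobian matrix;
    exchanging the two sums matches them. *)
Lemma pairing_nabla_change_chart X a i j p : is_vector_field U X ->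
  U p -> cdom (atlas i) p -> cdom (atlas j) p -> smooth_in j U a ->
  pairing i (nabla a) X p = pairing j (nabla a) X p.
Proof.
move=> [sX tX] Up ip jp sa; rewrite /pairing.
transitivity (\sum_(l < n) \sum_(m < n) dx j l a p *
    (dx i m (fun q => cmap (atlas j) q 0 l) p * X i p 0 m)).
  rewrite exchange_big /=; apply: eq_bigr => m _.
  rewrite mxE (dx_change_chart Up ip _ jp sa) mulr_suml.
  by apply: eq_bigr => l _; rewrite mulrA.
by apply: eq_bigr => l _; rewrite mxE (tX i j p)// mulr_sumr.
Qed.

Lemma lie_funE X a i p : is_vector_field U X -> smooth_fun U a ->
  U p -> cdom (atlas i) p -> lie_fun X a p = pairing i (nabla a) X p.
Proof.
move=> vX sa Up ip; rewrite lie_fun_chart_at.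
by apply: pairing_nabla_change_chart => //; [exact: cdom_chart_at|exact: sa].
Qed.

Lemma smooth_in_nabla i l a : smooth_in i U a ->
  smooth_in i U (fun q => nabla a i q 0 l).
Proof.
move=> sa; have H := smooth_in_dx oU l sa.
by apply: (smooth_in_ext oU _ H) => q _ _; rewrite mxE.
Qed.

Lemma smooth_nabla a : smooth_fun U a -> smooth_components U (nabla a).
Proof. by move=> sa i l; apply: smooth_in_nabla; exact: sa. Qed.

Lemma smooth_pairing i w X : smooth_components U w -> smooth_components U X ->
  smooth_in i U (pairing i w X).
Proof.
by move=> sw sX; apply: smooth_in_sum => // l; apply: smooth_inM.
Qed.

Lemma smooth_lie_fun X a : is_vector_field U X -> smooth_fun U a ->
  smooth_fun U (lie_fun X a).
Proof.
move=> vX sa i; apply: (smooth_in_ext oU (a := pairing i (nabla a) X)).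
  by move=> q Uq iq; rewrite (lie_funE vX sa Uq iq).
by apply: smooth_pairing; [exact: smooth_nabla|exact: vector_field_components].
Qed.

Lemma smooth_lie_covector X w : smooth_components U X -> smooth_components U w ->
  smooth_components U (lie_covector X w).
Proof.
move=> sX sw i l; have H : smooth_in i U (fun q => \sum_(m < n)
  (X i q 0 m * dx i m (fun q => w i q 0 l) q +
   w i q 0 m * dx i l (fun q => X i q 0 m) q)).
  apply: smooth_in_sum => // m; apply: smooth_inD => //; apply: smooth_inM => //;
    exact: smooth_in_dx.
by apply: (smooth_in_ext oU _ H) => q _ _; rewrite mxE.
Qed.

Lemma smooth_bracket X Y : smooth_components U X -> smooth_components U Y ->
  smooth_components U (bracket X Y).
Proof.
move=> sX sY i l; have H : smooth_in i U (fun q => \sum_(m < n)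
  (dx i m (fun q => Y i q 0 l) q * X i q 0 m -
   dx i m (fun q => X i q 0 l) q * Y i q 0 m)).
  apply: smooth_in_sum => // m; apply: smooth_inD => //; last apply: smooth_inN => //;
    apply: smooth_inM => //; exact: smooth_in_dx.
by apply: (smooth_in_ext oU _ H) => q _ _; rewrite mxE.
Qed.

Lemma smooth_scale a w : smooth_fun U a -> smooth_components U w ->
  smooth_components U (field_scale a w).
Proof.
move=> sa sw i l; apply: (smooth_in_ext oU _ (smooth_inM oU (sa i) (sw i l))).
by move=> q _ _; rewrite mxE.
Qed.

(** Leibniz rule for the contraction of [w] and [Y]: the derivatives of [X] occurring in the Lie
    derivative of [w] and in the bracket cancel each other. *)
Lemma pairing_lie i X Y w p : U p -> cdom (atlas i) p ->
  (forall l, smooth_in i U (fun q => Y i q 0 l)) ->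
  (forall l, smooth_in i U (fun q => w i q 0 l)) ->
  pairing i (nabla (pairing i w Y)) X p =
  pairing i (lie_covector X w) Y p + pairing i w (bracket X Y) p.
Proof.
move=> Up ip sY sw; rewrite /pairing.
transitivity (\sum_(l < n) \sum_(m < n)
    (w i p 0 l * dx i m (fun q => Y i q 0 l) p +
     Y i p 0 l * dx i m (fun q => w i q 0 l) p) * X i p 0 m).
  rewrite exchange_big /=; apply: eq_bigr => m _; rewrite mxE -mulr_suml.
  congr (_ * _); rewrite (dx_sum oU Up ip); last first.
    by move=> l; apply: smooth_inM.
  by apply: eq_bigr => l _; rewrite (dxM Up ip).
transitivity (\sum_(l < n) \sum_(m < n)
    (w i p 0 l * dx i m (fun q => Y i q 0 l) p * X i p 0 m +
     X i p 0 m * dx i m (fun q => w i q 0 l) p * Y i p 0 l)).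
  by apply: eq_bigr => l _; apply: eq_bigr => m _; ring.
(* These are the two sums containing derivatives of [X]; they differ only by the names of the
   indices. *)
have E : \sum_(l < n) \sum_(m < n)
      w i p 0 m * dx i l (fun q => X i q 0 m) p * Y i p 0 l =
    \sum_(l < n) \sum_(m < n)
      w i p 0 l * dx i m (fun q => X i q 0 l) p * Y i p 0 m.
  by rewrite exchange_big.
transitivity (\sum_(l < n) \sum_(m < n)
      (X i p 0 m * dx i m (fun q => w i q 0 l) p +
       w i p 0 m * dx i l (fun q => X i q 0 m) p) * Y i p 0 l +
   \sum_(l < n) \sum_(m < n)
      w i p 0 l * (dx i m (fun q => Y i q 0 l) p * X i p 0 m -
                   dx i m (fun q => X i q 0 l) p * Y i p 0 m)); last first.
  congr (_ + _); apply: eq_bigr => l _; rewrite mxE ?mulr_suml ?mulr_sumr//.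
apply/eqP; rewrite -subr_eq0; apply/eqP.
(* Zero is written as the difference of the two sums related by [E], after which the identity holds
   term by term. *)
rewrite -[RHS](subrr (\sum_(l < n) \sum_(m < n)
      w i p 0 l * dx i m (fun q => X i q 0 l) p * Y i p 0 m)) -{2}E.
rewrite -!sumrB -big_split /= -!sumrB; apply: eq_bigr => l _.
rewrite -!sumrB -big_split /= -!sumrB; apply: eq_bigr => m _.
ring.
Qed.

Lemma lie_covector_ext X w w' : eq_field_on U w w' ->
  eq_field_on U (lie_covector X w) (lie_covector X w').
Proof.
move=> ww i p Up ip; apply/rowP => l; rewrite !mxE; apply: eq_bigr => m _.
rewrite (dx_ext oU Up ip m (b := fun q => w' i q 0 l)) ?ww//.
by move=> q Uq iq; rewrite ww.
Qed.

Lemma bracket_extr X Y Y' : eq_field_on U Y Y' ->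
  eq_field_on U (bracket X Y) (bracket X Y').
Proof.
move=> YY i p Up ip; apply/rowP => l; rewrite !mxE; apply: eq_bigr => m _.
rewrite (dx_ext oU Up ip m (b := fun q => Y' i q 0 l)) ?YY//.
by move=> q Uq iq; rewrite YY.
Qed.

(** The Lie derivative commutes with the differential because second partial derivatives commute. *)
Lemma lie_covector_nabla_chart i X a p : U p -> cdom (atlas i) p ->
  (forall l, smooth_in i U (fun q => X i q 0 l)) -> smooth_in i U a ->
  lie_covector X (nabla a) i p = nabla (pairing i (nabla a) X) i p.
Proof.
move=> Up ip sX sa; apply/rowP => l; rewrite !mxE.
have E : dx i l (pairing i (nabla a) X) p =
    dx i l (fun q => \sum_(m < n) dx i m a q * X i q 0 m) p.
  by apply: (dx_ext oU Up ip) => q _ _; apply: eq_bigr => m _; rewrite mxE.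
rewrite {}E (dx_sum oU Up ip); last first.
  by move=> m; apply: smooth_inM => //; exact: smooth_in_dx.
apply: eq_bigr => m _; rewrite (dxM Up ip)//; last exact: smooth_in_dx.
rewrite addrC mxE; congr (_ + _); congr (_ * _).
rewrite -(dxC oU Up ip)//; apply: (dx_ext oU Up ip) => q _ _.
by rewrite mxE.
Qed.

Lemma lie_covector_nabla X a : is_vector_field U X -> smooth_fun U a ->
  eq_field_on U (lie_covector X (nabla a)) (nabla (lie_fun X a)).
Proof.
move=> vX sa i p Up ip.
rewrite (lie_covector_nabla_chart Up ip (vector_field_components vX i) (sa i))//.
apply/rowP => l; rewrite !mxE; apply: (dx_ext oU Up ip) => q Uq iq.
by rewrite (lie_funE vX sa Uq iq).
Qed.

End OpenSetFields.

(** The commutator formula, obtained from [pairing_lie] with the differential of [a] as covector. *)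
Lemma pairing_bracket U i X Y a p : open U -> U p -> cdom (atlas i) p ->
  (forall l, smooth_in i U (fun q => X i q 0 l)) ->
  (forall l, smooth_in i U (fun q => Y i q 0 l)) -> smooth_in i U a ->
  pairing i (nabla a) (bracket X Y) p =
  pairing i (nabla (pairing i (nabla a) Y)) X p -
  pairing i (nabla (pairing i (nabla a) X)) Y p.
Proof.
move=> oU Up ip sX sY sa.
rewrite (pairing_lie oU X Up ip sY (fun l => smooth_in_nabla oU l sa)).
rewrite {2}/pairing (lie_covector_nabla_chart oU Up ip sX sa).
by rewrite addrAC addrN add0r.
Qed.

(* The coordinate functions of the chart [j], differentiated in the chart [i],
   turn the commutator formula into the transformation law. *)
Lemma is_vector_field_bracket U X Y : open U -> is_vector_field U X ->
  is_vector_field U Y -> is_vector_field U (bracket X Y).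
Proof.
move=> oU vX vY; have [sX tX] := vX; have [sY tY] := vY.
split; first by apply: smooth_bracket.
move=> i j p Up ip jp l.
(* The coordinate [y] of chart [j] is known to be smooth in chart [i] only on the overlap, hence the
   smaller open set. *)
pose W := U `&` (cdom (atlas i) `&` cdom (atlas j)).
have oW : open W by do ?apply: openI => //; exact: cdom_open.
have WU : W `<=` U by move=> ? [].
have Wp : W p by split.
pose y q := cmap (atlas j) q 0 l.
have sy : smooth_in i W y.
  move=> k; apply: (diff_upto_sub _ (@atlas_compat _ _ M i j l k)).
  by apply: image_subset => q [[_ []]].
have Wy Z : is_vector_field U Z -> forall q, W q -> cdom (atlas i) q ->
    pairing i (nabla y) Z q = Z j q 0 l.
  move=> [_ tZ] q [Uq [iq jq]] _; rewrite (tZ i j)//.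
  by apply: eq_bigr => m _; rewrite mxE.
(* The inner pairing is a component of [Z] in chart [j], a genuine function near [p], so the outer
   pairing may be computed in chart [j] as well. *)
have nE Z Z' : is_vector_field U Z -> is_vector_field U Z' ->
    pairing i (nabla (pairing i (nabla y) Z)) Z' p =
    pairing j (nabla (fun q => Z j q 0 l)) Z' p.
  move=> vZ vZ'.
  transitivity (pairing i (nabla (fun q => Z j q 0 l)) Z' p).
    apply: eq_bigr => m _; rewrite !mxE; congr (_ * _).
    by apply: (dx_ext oW Wp ip) => q Wq iq; exact: Wy.
  apply: (pairing_nabla_change_chart vZ') => //.
  exact: (vector_field_components vZ j l).
transitivity (pairing i (nabla y) (bracket X Y) p); last first.
  by apply: eq_bigr => m _; rewrite mxE.
rewrite (pairing_bracket oW Wp ip) => [|m|m|//].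
- rewrite !nE// /pairing mxE -sumrB; apply: eq_bigr => m _.
  by rewrite !mxE.
- exact: (smooth_in_sub (a := fun q => X i q 0 m) WU (sX i m)).
- exact: (smooth_in_sub (a := fun q => Y i q 0 m) WU (sY i m)).
Qed.

Lemma is_vector_field_scale U a X : open U -> smooth_fun U a ->
  is_vector_field U X -> is_vector_field U (field_scale a X).
Proof.
move=> oU sa [sX tX]; split; first exact: smooth_scale.
move=> i j p Up ip jp l; rewrite mxE (tX i j)// mulr_sumr.
by apply: eq_bigr => m _; rewrite mxE mulrCA.
Qed.

End ChartCalculus.

(** * Modules of fields over the smooth functions *)

Section FunctionModules.
Variables (R : realType) (n : nat) (M : smooth_manifold R n) (U : set M).
Hypothesis oU : open U.
Implicit Types (A B S T : set (tfield M)) (X v w : tfield M).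

(** Modules over the smooth functions, saturated for agreement on [U]. Spans and sums are the least
    ones containing their generators, so inclusions are checked on generators. *)
Record function_module A : Prop := FunctionModule {
  fmodule_ext : forall v w, eq_field_on U w v -> A v -> A w;
  fmodule0 : A (fun _ _ => 0);
  fmoduleD : forall v w, A v -> A w -> A (field_add v w);
  fmoduleZ : forall a v, smooth_fun U a -> A v -> A (field_scale a v)
}.

Lemma smooth_fun_cst (c : R) : smooth_fun U (fun _ => c).
Proof. by move=> i; exact: smooth_in_cst. Qed.

Lemma smooth_funM (a b : M -> R) : smooth_fun U a -> smooth_fun U b ->
  smooth_fun U (fun q => a q * b q).
Proof. by move=> sa sb i; apply: (smooth_inM oU); [exact: sa|exact: sb]. Qed.

Lemma fmodule_sum A k (v : 'I_k -> tfield M) : function_module A ->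
  (forall e, A (v e)) -> A (fun i p => \sum_(e < k) v e i p).
Proof.
move=> mA; elim: k v => [|k IH] v Av.
  by apply: (fmodule_ext mA) (fmodule0 mA) => i p _ _; rewrite big_ord0.
apply: (fmodule_ext mA) (fmoduleD mA (IH (fun e => v (widen_ord (leqnSn k) e))
  (fun e => Av _)) (Av ord_max)) => i p _ _.
by rewrite big_ord_recr.
Qed.

Lemma fspan_module S : function_module (fspan U S).
Proof.
split.
- move=> v w wv [k [a [x [ax vE]]]]; exists k, a, x; split=> // i p Up ip.
  by rewrite wv// vE.
- exists 0%N, (fun _ _ => 0), (fun _ _ _ => 0); split; first by case.
  by move=> i p _ _; rewrite big_ord0.
- move=> v w [k1 [a1 [x1 [ax1 vE]]]] [k2 [a2 [x2 [ax2 wE]]]].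
  exists (k1 + k2)%N,
    (fun e => match fintype.split e with inl e => a1 e | inr e => a2 e end),
    (fun e => match fintype.split e with inl e => x1 e | inr e => x2 e end).
  split; first by move=> e; case: (fintype.split e).
  move=> i p Up ip; rewrite big_split_ord /= /field_add vE// wE//.
  by congr (_ + _); apply: eq_bigr => e _;
    rewrite -1?[lshift _ _]/(unsplit (inl _)) -1?[rshift _ _]/(unsplit (inr _))
      unsplitK.
- move=> a v sa [k [b [x [bx vE]]]].
  exists k, (fun e q => a q * b e q), x; split.
    by move=> e; have [sb Sx] := bx e; split=> //; exact: smooth_funM.
  move=> i p Up ip; rewrite /field_scale vE// scaler_sumr.
  by apply: eq_bigr => e _; rewrite scalerA.
Qed.

Lemma sub_fspan S : S `<=` fspan U S.
Proof.
move=> v Sv; exists 1%N, (fun _ _ => 1), (fun _ => v); split.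
  by move=> _; split=> //; exact: smooth_fun_cst.
by move=> i p _ _; rewrite big_ord1 /field_scale scale1r.
Qed.

Lemma fspan_min S A : function_module A -> S `<=` A -> fspan U S `<=` A.
Proof.
move=> mA SA w [k [a [x [ax wE]]]]; apply: (fmodule_ext mA wE).
by apply: fmodule_sum => // e; have [sa /SA] := ax e; exact: fmoduleZ.
Qed.

Lemma dsum_module A B : function_module A -> function_module B ->
  function_module (dsum U A B).
Proof.
move=> mA mB; split.
- move=> v w wv [v1 [v2 [A1 [B2 vE]]]]; exists v1, v2; do !split=> //.
  by move=> i p Up ip; rewrite wv// vE.
- exists (fun _ _ => 0), (fun _ _ => 0).
  do !split; try exact: fmodule0.
  by move=> i p _ _; rewrite /field_add addr0.
- move=> v w [v1 [v2 [A1 [B2 vE]]]] [w1 [w2 [A1' [B2' wE]]]].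
  exists (field_add v1 w1), (field_add v2 w2).
  do !split; try exact: fmoduleD.
  by move=> i p Up ip; rewrite /field_add vE// wE// /field_add addrACA.
- move=> a v sa [v1 [v2 [A1 [B2 vE]]]].
  exists (field_scale a v1), (field_scale a v2).
  do !split; try exact: fmoduleZ.
  by move=> i p Up ip; rewrite /field_scale vE// /field_add scalerDr.
Qed.

Lemma dsum_min A B T : function_module T -> A `<=` T -> B `<=` T ->
  dsum U A B `<=` T.
Proof.
move=> mT AT BT w [v1 [v2 [A1 [B2 wE]]]]; apply: (fmodule_ext mT wE).
by apply: (fmoduleD mT); [exact: AT|exact: BT].
Qed.

Lemma sub_dsuml A B : function_module B -> A `<=` dsum U A B.
Proof.
move=> mB v Av; exists v, (fun _ _ => 0); split=> //; split; first exact: fmodule0.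
by move=> i p _ _; rewrite /field_add addr0.
Qed.

Lemma sub_dsumr A B : function_module A -> B `<=` dsum U A B.
Proof.
move=> mA v Bv; exists (fun _ _ => 0), v; split; first exact: fmodule0.
by split=> // i p _ _; rewrite /field_add add0r.
Qed.

Lemma bigdsum_module (I : Type) (r : seq I) (F : I -> set (tfield M)) :
  (forall e, function_module (F e)) ->
  function_module (\big[dsum U / fspan U set0]_(e <- r) F e).
Proof.
move=> mF; elim: r => [|x r IH]; first by rewrite big_nil; exact: fspan_module.
by rewrite big_cons; exact: dsum_module.
Qed.

Lemma sub_bigdsum (I : eqType) (r : seq I) (F : I -> set (tfield M)) x :
  (forall e, function_module (F e)) -> x \in r ->
  F x `<=` \big[dsum U / fspan U set0]_(e <- r) F e.
Proof.
move=> mF; elim: r => [//|y r IH]; rewrite inE big_cons => /orP[/eqP ->|xr].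
  by apply: sub_dsuml; exact: bigdsum_module.
exact: subset_trans (IH xr) (sub_dsumr _).
Qed.

Lemma bigdsum_min (I : eqType) (r : seq I) (F : I -> set (tfield M)) T :
  function_module T -> (forall x, x \in r -> F x `<=` T) ->
  \big[dsum U / fspan U set0]_(e <- r) F e `<=` T.
Proof.
move=> mT; elim: r => [|y r IH] FT; first by rewrite big_nil; exact: fspan_min.
rewrite big_cons; apply: dsum_min => //; first by apply: FT; rewrite mem_head.
by apply: IH => x xr; apply: FT; rewrite inE xr orbT.
Qed.

Lemma lie_codistr_module X A : function_module (lie_codistr U X A).
Proof. exact: fspan_module. Qed.

Lemma lie_codistrS X A B : A `<=` B -> lie_codistr U X A `<=` lie_codistr U X B.
Proof.
move=> AB; apply: fspan_min; first exact: lie_codistr_module.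
by apply: subset_trans (@sub_fspan _); exact: image_subset.
Qed.

Lemma sub_lie_codistr X A w : A w -> lie_codistr U X A (lie_covector X w).
Proof. by move=> Aw; apply: sub_fspan; exists w. Qed.

(** * Leibniz rules for combinations with function coefficients *)

Lemma lie_covector_lincomb X k (a : 'I_k -> M -> R) (v : 'I_k -> tfield M) :
  is_vector_field U X -> (forall e, smooth_fun U (a e)) ->
  (forall e, smooth_components U (v e)) ->
  eq_field_on U
    (lie_covector X (fun i p => \sum_(e < k) field_scale (a e) (v e) i p))
    (fun i p => \sum_(e < k) field_add (field_scale (a e) (lie_covector X (v e)))
                                       (field_scale (lie_fun X (a e)) (v e)) i p).
Proof.
move=> vX sa sv i p Up ip; apply/rowP => l; rewrite mxE summxE.
transitivity (\sum_(e < k) \sum_(m < n)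
    (X i p 0 m * (a e p * dx i m (fun q => v e i q 0 l) p +
                  v e i p 0 l * dx i m (a e) p) +
     a e p * v e i p 0 m * dx i l (fun q => X i q 0 m) p)).
  rewrite exchange_big /=; apply: eq_bigr => m _; rewrite big_split /=.
  congr (_ + _); last first.
    by rewrite summxE mulr_suml; apply: eq_bigr => e _; rewrite mxE.
  rewrite -mulr_sumr; congr (_ * _).
  rewrite (dx_ext oU Up ip m (b := fun q => \sum_(e < k) a e q * v e i q 0 l)).
    rewrite (dx_sum oU Up ip); last first.
      by move=> e; apply: (smooth_inM oU); [exact: sa|exact: sv].
    by apply: eq_bigr => e _; rewrite (dxM Up ip); [|exact: sa|exact: sv].
  by move=> q _ _; rewrite summxE; apply: eq_bigr => e _; rewrite mxE.
apply: eq_bigr => e _; rewrite !mxE (lie_funE vX (sa e) Up ip).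
rewrite /pairing mulr_sumr mulr_suml -big_split /=; apply: eq_bigr => m _.
by rewrite mxE; ring.
Qed.

Lemma bracket_lincomb X k (a : 'I_k -> M -> R) (v : 'I_k -> tfield M) :
  is_vector_field U X -> (forall e, smooth_fun U (a e)) ->
  (forall e, smooth_components U (v e)) ->
  eq_field_on U
    (bracket X (fun i p => \sum_(e < k) field_scale (a e) (v e) i p))
    (fun i p => \sum_(e < k) field_add (field_scale (a e) (bracket X (v e)))
                                       (field_scale (lie_fun X (a e)) (v e)) i p).
Proof.
move=> vX sa sv i p Up ip; apply/rowP => l; rewrite mxE summxE.
transitivity (\sum_(e < k) \sum_(m < n)
    ((a e p * dx i m (fun q => v e i q 0 l) p +
                  v e i p 0 l * dx i m (a e) p) * X i p 0 m -
     dx i m (fun q => X i q 0 l) p * (a e p * v e i p 0 m))).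
  rewrite exchange_big /=; apply: eq_bigr => m _; rewrite sumrB.
  congr (_ - _); last first.
    by rewrite summxE mulr_sumr; apply: eq_bigr => e _; rewrite mxE.
  rewrite -mulr_suml; congr (_ * _).
  rewrite (dx_ext oU Up ip m (b := fun q => \sum_(e < k) a e q * v e i q 0 l)).
    rewrite (dx_sum oU Up ip); last first.
      by move=> e; apply: (smooth_inM oU); [exact: sa|exact: sv].
    by apply: eq_bigr => e _; rewrite (dxM Up ip); [|exact: sa|exact: sv].
  by move=> q _ _; rewrite summxE; apply: eq_bigr => e _; rewrite mxE.
apply: eq_bigr => e _; rewrite !mxE (lie_funE vX (sa e) Up ip).
rewrite /pairing mulr_sumr mulr_suml -big_split /=; apply: eq_bigr => m _.
by rewrite mxE; ring.
Qed.

(** Differentiating the coefficients brings back the generators themselves, which is why [A] has to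
    contain each generator along with its Lie derivative. *)
Lemma lie_covector_fspan X S A w : is_vector_field U X -> function_module A ->
  (forall v, S v -> [/\ smooth_components U v, A v & A (lie_covector X v)]) ->
  fspan U S w -> A (lie_covector X w).
Proof.
move=> vX mA SA [k [a [v [av wE]]]].
apply: (fmodule_ext mA (lie_covector_ext oU _ wE)).
have sa e : smooth_fun U (a e) by have [] := av e.
have Sv e : S (v e) by have [] := av e.
apply: (fmodule_ext mA (lie_covector_lincomb vX sa _)).
  by move=> e; have [] := SA _ (Sv e).
apply: fmodule_sum => // e; have [_ Ave ALe] := SA _ (Sv e).
apply: (fmoduleD mA); apply: (fmoduleZ mA) => //.
exact: (smooth_lie_fun oU).
Qed.

Lemma bracket_fspan X S A w : is_vector_field U X -> function_module A ->
  (forall v, S v -> [/\ smooth_components U v, A v & A (bracket X v)]) ->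
  fspan U S w -> A (bracket X w).
Proof.
move=> vX mA SA [k [a [v [av wE]]]].
apply: (fmodule_ext mA (bracket_extr oU _ wE)).
have sa e : smooth_fun U (a e) by have [] := av e.
have Sv e : S (v e) by have [] := av e.
apply: (fmodule_ext mA (bracket_lincomb vX sa _)).
  by move=> e; have [] := SA _ (Sv e).
apply: fmodule_sum => // e; have [_ Ave ALe] := SA _ (Sv e).
apply: (fmoduleD mA); apply: (fmoduleZ mA) => //.
exact: (smooth_lie_fun oU).
Qed.

End FunctionModules.

(** * The observability codistributions *)

(** Induction on the antidiagonals. Those up to [s + r] are filled from row 0 by [up]; on each later
    one, [corner] supplies the entry in row [s], from which [up] and [down] reach all the others. *)
Lemma antidiagonal_propagation (G : nat -> nat -> Prop) (s r : nat) :
  (forall i j, G i j -> G i j.+1 -> G i.+1 j) ->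
  (forall i j, G i j -> G i.+1 j -> G i j.+1) ->
  (forall j, (j <= s + r)%N -> G 0%N j) ->
  (forall j, (forall i, (i < s)%N -> G i j) ->
     (forall i j', (i <= s)%N -> (j' <= r)%N -> G i j') -> G s j) ->
  forall i j, G i j.
Proof.
move=> up down base corner.
suff P N i j : (i + j <= s + r + N)%N -> G i j.
  by move=> i j; apply: (P (i + j)%N); rewrite leq_addl.
elim: N i j => [|N IH].
  rewrite addn0; elim=> [|i IHi] j ij; first exact: base.
  by apply: up; apply: IHi; lia.
(* The premises of [corner] lie on earlier antidiagonals: the rows below [s] in this column sum to
   at most [s + r + N], and the block of small indices to at most [s + r]. *)
have Gs : G s (r + N.+1)%N.
  by apply: corner => [i is_|i j' ? ?]; apply: IH; lia.
(* Moving along the antidiagonal, each use of [up] or [down] combines the neighbour just obtained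
   with one entry of the previous antidiagonal. *)
have Gup d e : (d + e)%N = (r + N.+1)%N -> G (s + d)%N e.
  elim: d e => [|d IHd] e; first by rewrite add0n addn0 => ->.
  move=> de; rewrite addnS; apply: up; first by apply: IH; lia.
  by apply: IHd; lia.
have Gdown d i : (i + d)%N = s -> G i (r + N.+1 + d)%N.
  elim: d i => [|d IHd] i; first by rewrite !addn0 => ->.
  move=> ids; rewrite addnS; apply: down; first by apply: IH; lia.
  by apply: IHd; lia.
move=> i j ij; have [ij'|ij'] := leqP (i + j) (s + r + N); first exact: IH.
have {ij ij'} E : (i + j)%N = (s + r + N.+1)%N by lia.
have [si|/ltnW si] := leqP s i.
  by rewrite -(subnKC si); apply: Gup; lia.
have -> : j = (r + N.+1 + (s - i))%N by lia.
by apply: Gdown; lia.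
Qed.

(** * The covectors [lie_iter], the autobrackets and their pairings *)

Section System.
Variables (R : realType) (n : nat) (M : smooth_manifold R n) (U : set M).
Variables (f g : tfield M) (h : M -> R).
Hypotheses (oU : open U) (vf : is_vector_field U f) (vg : is_vector_field U g).
Hypotheses (sh : smooth_fun U h) (L0 : forall q, U q -> lie_fun g h q != 0).

Let iL q := (lie_fun g h q)^-1.
Let phi j := autobracket_iter g h j f.

Lemma smooth_lie_inv : smooth_fun U (fun q => (lie_fun g h q)^-1).
Proof.
move=> i; apply: (smooth_inV (a := lie_fun g h) oU) => //.
by have := smooth_lie_fun oU vg sh; exact.
Qed.

Lemma is_vector_field_ghat : is_vector_field U (ghat g h).
Proof. by apply: is_vector_field_scale => //; exact: smooth_lie_inv. Qed.

Lemma is_vector_field_autobracket_iter j :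
  is_vector_field U (autobracket_iter g h j f).
Proof.
elim: j => [//|j IH]; rewrite /autobracket_iter iterS.
apply: is_vector_field_scale => //; first exact: smooth_lie_inv.
exact: is_vector_field_bracket.
Qed.

(** The inverse factor stands outside the Lie derivative along [g], as in the autobracket. A Lie
    derivative along [ghat] would add a multiple of the differential of that factor. *)
Fixpoint lie_iter (i : nat) : tfield M :=
  if i is i'.+1 then
    field_scale (fun q => (lie_fun g h q)^-1) (lie_covector g (lie_iter i'))
  else nabla h.

Lemma smooth_lie_iter i : smooth_components U (lie_iter i).
Proof.
elim: i => [|i IH]; first exact: smooth_nabla.
apply: smooth_scale => //; first exact: smooth_lie_inv.
by apply: smooth_lie_covector => //; exact: vector_field_components.
Qed.

(* The pairing of [lie_iter i] with the [j]-th autobracket of [f]; defined by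
   the recursion it satisfies so as to be visibly chart independent. *)
Fixpoint lie_pair (i j : nat) : M -> R :=
  if i is i'.+1 then
    fun q => lie_fun (ghat g h) (lie_pair i' j) q - lie_pair i' j.+1 q
  else lie_fun (autobracket_iter g h j f) h.

Lemma smooth_lie_pair i j : smooth_fun U (lie_pair i j).
Proof.
elim: i j => [|i IH] j.
  by apply: smooth_lie_fun => //; exact: is_vector_field_autobracket_iter.
move=> c; apply: (smooth_inD oU); last by apply: (smooth_inN oU); exact: IH.
by have := smooth_lie_fun oU is_vector_field_ghat (IH j); exact.
Qed.

(** Dividing [pairing_lie] along [g] by the Lie derivative of [h] gives exactly the recursion
    defining [lie_pair]. *)
Lemma lie_pairE i j c p : U p -> cdom (atlas c) p ->
  lie_pair i j p = pairing c (lie_iter i) (autobracket_iter g h j f) p.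
Proof.
(* The point is generalized because the induction hypothesis is used under a derivative, hence on a
   neighbourhood. *)
move=> + cp; elim: i j p cp => [|i IH] j p cp Up.
  by apply: lie_funE Up cp => //; exact: is_vector_field_autobracket_iter.
rewrite /= (lie_funE is_vector_field_ghat (smooth_lie_pair i j) Up cp).
have -> : pairing c (nabla (lie_pair i j)) (ghat g h) p =
    iL p * pairing c (nabla (lie_pair i j)) g p.
  rewrite /pairing mulr_sumr; apply: eq_bigr => l _.
  by rewrite [ghat _ _ _ _ _ _]mxE mulrCA.
have -> : pairing c (nabla (lie_pair i j)) g p =
    pairing c (nabla (pairing c (lie_iter i) (phi j))) g p.
  apply: eq_bigr => l _; rewrite !mxE; congr (_ * _).
  by apply: (dx_ext oU Up cp) => q Uq cq; rewrite IH.
rewrite (pairing_lie oU)//; last 2 first.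
- exact: (vector_field_components (is_vector_field_autobracket_iter j) c).
- exact: (smooth_lie_iter i c).
rewrite IH// mulrDr.
have -> : pairing c (lie_iter i) (autobracket_iter g h j.+1 f) p =
    iL p * pairing c (lie_iter i) (bracket g (phi j)) p.
  rewrite /pairing mulr_sumr; apply: eq_bigr => l _.
  by rewrite mxE mulrCA.
rewrite addrK /pairing mulr_sumr; apply: eq_bigr => l _.
by rewrite [in RHS]mxE mulrA.
Qed.

(** The Lie derivative of [lie_iter i] along [g] is a smooth multiple of [lie_iter i.+1], so by the
    Leibniz rule each step of the recursion adds one generator. *)
Lemma Omega_g_sub_fspan k : Omega_g U g h k `<=`
  fspan U [set w | exists2 i, (i <= k)%N & w = lie_iter i].
Proof.
have mS k' : function_module U
    (fspan U [set w | exists2 i, (i <= k')%N & w = lie_iter i]).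
  exact: (fspan_module oU).
elim: k => [|k IH] /=.
  by apply: fspan_min => // _ ->; apply: sub_fspan; exists 0%N.
apply: dsum_min => //.
  apply: subset_trans IH _; apply: fspan_min => // _ [i ik ->].
  by apply: sub_fspan; exists i => //; exact: leqW.
apply: fspan_min => // _ [w /IH Sw <-].
apply: (lie_covector_fspan oU vg (mS _) _ Sw) => _ [i ik ->]; split.
- exact: smooth_lie_iter.
- by apply: sub_fspan; exists i => //; exact: leqW.
- apply: (fmodule_ext (mS _) (v := field_scale (lie_fun g h) (lie_iter i.+1))).
    move=> c p Up cp; rewrite /= /field_scale scalerA divff ?scale1r//.
    exact: L0.
  apply: (fmoduleZ (mS _)); first exact: smooth_lie_fun.
  by apply: sub_fspan; exists i.+1.
Qed.

Lemma lie_iter_Omega_g k : Omega_g U g h k (lie_iter k).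
Proof.
have mO k' : function_module U (Omega_g U g h k').
  elim: k' => [|k' IH]; first exact: (fspan_module oU).
  by apply: dsum_module => //; exact: (lie_codistr_module oU).
elim: k => [|k IH]; first exact: sub_fspan.
apply: (fmoduleZ (mO k.+1)); first exact: smooth_lie_inv.
apply: sub_dsumr; first exact: mO.
exact: sub_lie_codistr.
Qed.

(** Same argument with brackets: the bracket of [g] with an iterated autobracket is a smooth
    multiple of the next one. *)
Lemma Delta_sub_fspan k : Delta U f g h k `<=`
  fspan U [set v | exists2 j, (j <= k)%N & v = autobracket_iter g h j f].
Proof.
have mS k' : function_module U
    (fspan U [set v | exists2 j, (j <= k')%N & v = autobracket_iter g h j f]).
  exact: (fspan_module oU).
elim: k => [|k IH] /=.
  by apply: fspan_min => // _ ->; apply: sub_fspan; exists 0%N.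
apply: dsum_min => //.
  apply: subset_trans IH _; apply: fspan_min => // _ [i ik ->].
  by apply: sub_fspan; exists i => //; exact: leqW.
apply: fspan_min => // _ [v /IH Sv <-].
apply: (fmoduleZ (mS _)); first exact: smooth_lie_inv.
apply: (bracket_fspan oU vg (mS _) _ Sv) => _ [j jk ->]; split.
- exact/vector_field_components/is_vector_field_autobracket_iter.
- by apply: sub_fspan; exists j => //; exact: leqW.
- apply: (fmodule_ext (mS _)
    (v := field_scale (lie_fun g h) (autobracket_iter g h j.+1 f))).
    move=> c p Up cp; rewrite /= /autobracket /field_scale scalerA divff ?scale1r//.
    exact: L0.
  apply: (fmoduleZ (mS _)); first exact: smooth_lie_fun.
  by apply: sub_fspan; exists j.+1.
Qed.

(** Once two consecutive steps agree, the distribution is stable under the autobracket, and it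
    contains [f]. *)
Lemma autobracket_iter_Delta r j : Delta U f g h r.+1 = Delta U f g h r ->
  Delta U f g h r (autobracket_iter g h j f).
Proof.
move=> Er.
have mD k' : function_module U (Delta U f g h k').
  elim: k' => [|k' IH]; first exact: (fspan_module oU).
  by apply: dsum_module => //; exact: (fspan_module oU).
elim: j => [|j IH].
  elim: r {Er} => [|r IHr]; first exact: sub_fspan.
  by apply: sub_dsuml => //; exact: (fspan_module oU).
rewrite -Er; apply: sub_dsumr; first exact: mD.
by apply: sub_fspan; exists (autobracket_iter g h j f).
Qed.

(** * Codistributions stable under the Lie derivative along [ghat] *)

Section Invariant.
Variable A : set (tfield M).
Hypotheses (mA : function_module U A)
  (Aghat : lie_codistr U (ghat g h) A `<=` A).

Lemma nabla_lie_pair_rec i j :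
  eq_field_on U (lie_covector (ghat g h) (nabla (lie_pair i j)))
    (field_add (nabla (lie_pair i.+1 j)) (nabla (lie_pair i j.+1))).
Proof.
move=> c p Up cp; rewrite (lie_covector_nabla oU is_vector_field_ghat)//; last first.
  exact: smooth_lie_pair.
apply/rowP => l; rewrite !mxE /=.
rewrite (dxB oU Up cp); [by rewrite subrK| |exact: smooth_lie_pair].
by have := smooth_lie_fun oU is_vector_field_ghat (smooth_lie_pair i j); exact.
Qed.

Lemma fmodule_addKr v w : A (field_add v w) -> A w -> A v.
Proof.
move=> Avw Aw.
have AN : A (field_scale (fun _ => -1) w).
  by apply: (fmoduleZ mA) => //; exact: smooth_fun_cst.
apply: (fmodule_ext mA) (fmoduleD mA Avw AN) => c p _ _.
by rewrite /field_add /field_scale scaleN1r addrK.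
Qed.

Lemma nabla_lie_pair_sum i j : A (nabla (lie_pair i j)) ->
  A (field_add (nabla (lie_pair i.+1 j)) (nabla (lie_pair i j.+1))).
Proof.
move=> Aij; have := Aghat (@sub_lie_codistr _ _ _ U (ghat g h) _ _ Aij).
by apply: (fmodule_ext mA) => c p Up cp; rewrite nabla_lie_pair_rec.
Qed.

(** Only the expansion of the autobracket is differentiated; that of [lie_iter s] is used pointwise,
    so the differentials of its coefficients never appear. Those of the [b e] are eliminated through
    the expansions of the rows [ii e], all below [s]. *)
Lemma nabla_lie_pair_corner s r j :
  (0 < s)%N -> Omega_g U g h s = Omega_g U g h s.-1 ->
  Delta U f g h r.+1 = Delta U f g h r ->
  (forall i, (i < s)%N -> A (nabla (lie_pair i j))) ->
  (forall i j', (i <= s)%N -> (j' <= r)%N -> A (nabla (lie_pair i j'))) ->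
  A (nabla (lie_pair s j)).
Proof.
move=> s0 Es Er Gj G.
have := @lie_iter_Omega_g s; rewrite Es => /Omega_g_sub_fspan.
move=> [k1 [a [x [ax wE]]]].
have /choice[ii iiP] : forall e, exists i, (i < s)%N /\ x e = lie_iter i.
  move=> e; have [_ [i is_ xe]] := ax e; exists i; split=> //.
  by move: is_; rewrite -ltnS prednK.
have sa e : smooth_fun U (a e) by have [] := ax e.
have := @autobracket_iter_Delta r j Er => /Delta_sub_fspan.
move=> [k2 [b [y [bY vE]]]].
have /choice[jj jjP] : forall e, exists j', (j' <= r)%N /\ y e = phi j'.
  by move=> e; have [_ [i is_ ye]] := bY e; exists i.
have sb e : smooth_fun U (b e) by have [] := bY e.
(* The coefficients in a span are functions common to all charts, so the expansion may be evaluated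
   in any chart around [p]. *)
have Er1 j' p : U p ->
    lie_pair s j' p = \sum_(e < k1) a e p * lie_pair (ii e) j' p.
  move=> Up; have cp := cdom_chart_at p.
  rewrite (lie_pairE _ _ Up cp) /pairing.
  rewrite wE//; transitivity (\sum_(l < n) \sum_(e < k1)
      a e p * (lie_iter (ii e) (chart_at p) p 0 l * phi j' (chart_at p) p 0 l)).
    apply: eq_bigr => l _; rewrite summxE mulr_suml; apply: eq_bigr => e _.
    by rewrite mxE (iiP e).2 mulrA.
  rewrite exchange_big; apply: eq_bigr => e _ /=.
  by rewrite -mulr_sumr (lie_pairE _ _ Up cp).
have Ec i p : U p -> lie_pair i j p = \sum_(e < k2) b e p * lie_pair i (jj e) p.
  move=> Up; have cp := cdom_chart_at p.
  rewrite (lie_pairE _ _ Up cp) /pairing.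
  rewrite vE//; transitivity (\sum_(l < n) \sum_(e < k2)
      b e p * (lie_iter i (chart_at p) p 0 l * phi (jj e) (chart_at p) p 0 l)).
    apply: eq_bigr => l _; rewrite summxE mulr_sumr; apply: eq_bigr => e _.
    by rewrite mxE (jjP e).2 mulrCA.
  rewrite exchange_big; apply: eq_bigr => e _ /=.
  by rewrite -mulr_sumr (lie_pairE _ _ Up cp).
have dE i c p l : U p -> cdom (atlas c) p -> dx c l (lie_pair i j) p =
    \sum_(e < k2) (b e p * dx c l (lie_pair i (jj e)) p +
                   lie_pair i (jj e) p * dx c l (b e) p).
  move=> Up cp.
  rewrite (dx_ext oU Up cp l
    (b := fun q => \sum_(e < k2) b e q * lie_pair i (jj e) q)).
    rewrite (dx_sum oU Up cp); last first.
      by move=> e; apply: (smooth_inM oU); [exact: sb|exact: smooth_lie_pair].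
    apply: eq_bigr => e _; rewrite (dxM Up cp)//; first exact: sb.
    exact: smooth_lie_pair.
  by move=> q Uq cq; exact: Ec.
(* [va i] is the differential of [lie_pair i j] without the terms in the differentials of the [b e];
   [vb] recombines the differences left in the rows [ii e] into the terms missing in row [s]. *)
pose va i : tfield M := fun c p =>
  \sum_(e < k2) field_scale (b e) (nabla (lie_pair i (jj e))) c p.
pose vb : tfield M := fun c p => \sum_(e < k1) field_scale (a e)
  (field_add (nabla (lie_pair (ii e) j)) (field_scale (fun _ => -1) (va (ii e)))) c p.
have Ava i : (i <= s)%N -> A (va i).
  move=> is_; apply: (fmodule_sum mA) => e; apply: (fmoduleZ mA); first exact: sb.
  by apply: G => //; have [] := jjP e.
have Avb : A vb.
  apply: (fmodule_sum mA) => e; apply: (fmoduleZ mA); first exact: sa.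
  have [ie _] := iiP e; apply: (fmoduleD mA); first exact: Gj.
  by apply: (fmoduleZ mA); [exact: smooth_fun_cst|apply: Ava; exact: ltnW].
apply: (fmodule_ext mA) (fmoduleD mA (Ava s (leqnn s)) Avb) => c p Up cp.
apply/rowP => l; rewrite !mxE dE// big_split /=; congr (_ + _).
  by rewrite summxE; apply: eq_bigr => e _; rewrite !mxE.
rewrite summxE.
transitivity (\sum_(e < k1) \sum_(e' < k2)
    a e p * lie_pair (ii e) (jj e') p * dx c l (b e') p).
  rewrite exchange_big; apply: eq_bigr => e' _ /=.
  by rewrite Er1// mulr_suml.
apply: eq_bigr => e _; rewrite !mxE summxE dE// mulN1r -sumrN -big_split /=.
rewrite mulr_sumr; apply: eq_bigr => e' _; rewrite !mxE.
ring.
Qed.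

(** The propagation is run on all pairs of indices, and only its row 0 is read off. *)
Lemma nabla_lie_pair_mem s r :
  (0 < s)%N -> Omega_g U g h s = Omega_g U g h s.-1 ->
  Delta U f g h r.+1 = Delta U f g h r ->
  (forall j, (j <= s + r)%N -> A (nabla (lie_fun (autobracket_iter g h j f) h))) ->
  forall j, A (nabla (lie_fun (autobracket_iter g h j f) h)).
Proof.
move=> s0 Es Er base j.
apply: (@antidiagonal_propagation (fun i j => A (nabla (lie_pair i j))) s r _ _ base
  _ 0%N j).
- by move=> i k /nabla_lie_pair_sum; exact: fmodule_addKr.
- move=> i k /nabla_lie_pair_sum Aik Ai; apply: fmodule_addKr Ai.
  by apply: (fmodule_ext mA) Aik => c p _ _; rewrite /field_add addrC.
- by move=> k; exact: nabla_lie_pair_corner.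
Qed.

End Invariant.

(** * Comparison of the two sequences of codistributions *)

Variables (p : nat) (hs : 'I_p -> M -> R).

Lemma O_seq_module s r k : function_module U (O_seq U f g hs h s r k).
Proof.
elim: k => [|k IH] /=.
  apply: dsum_module; last exact: (fspan_module oU).
  by apply: (bigdsum_module oU) => j; exact: (fspan_module oU).
by do 2 ?apply: dsum_module => //; exact: (lie_codistr_module oU).
Qed.

Lemma Omega_module k : function_module U (Omega U f g hs h k).
Proof.
elim: k => [|k IH] /=; first exact: (fspan_module oU).
by do 3 ?apply: dsum_module => //; exact: (fspan_module oU).
Qed.

Lemma O_seqS s r k : O_seq U f g hs h s r k `<=` O_seq U f g hs h s r k.+1.
Proof.
have mO := O_seq_module s r k.
apply: subset_trans (sub_dsuml (lie_codistr_module oU _ _)).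
exact/sub_dsuml/(lie_codistr_module oU).
Qed.

Lemma O_seq_lie_f s r k :
  lie_codistr U f (O_seq U f g hs h s r k) `<=` O_seq U f g hs h s r k.+1.
Proof.
apply: subset_trans (sub_dsuml (lie_codistr_module oU _ _)).
exact/sub_dsumr/O_seq_module.
Qed.

Lemma O_seq_lie_ghat s r k :
  lie_codistr U (ghat g h) (O_seq U f g hs h s r k) `<=`
  O_seq U f g hs h s r k.+1.
Proof.
apply/sub_dsumr/dsum_module; [exact: O_seq_module|exact: (lie_codistr_module oU)].
Qed.

Lemma O_seq0_sub s r k : O_seq U f g hs h s r 0 `<=` O_seq U f g hs h s r k.
Proof.
by elim: k => [//|k IH]; apply: subset_trans IH _; exact: O_seqS.
Qed.

Lemma OmegaS k : Omega U f g hs h k `<=` Omega U f g hs h k.+1.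
Proof.
have mO := Omega_module k.
apply: subset_trans (sub_dsuml (fspan_module oU _)).
apply: subset_trans (sub_dsuml (lie_codistr_module oU _ _)).
exact/sub_dsuml/(lie_codistr_module oU).
Qed.

Lemma Omega_lie_f k :
  lie_codistr U f (Omega U f g hs h k) `<=` Omega U f g hs h k.+1.
Proof.
apply: subset_trans (sub_dsuml (fspan_module oU _)).
apply: subset_trans (sub_dsuml (lie_codistr_module oU _ _)).
exact/sub_dsumr/Omega_module.
Qed.

Lemma Omega_lie_ghat k :
  lie_codistr U (ghat g h) (Omega U f g hs h k) `<=` Omega U f g hs h k.+1.
Proof.
apply: subset_trans (sub_dsuml (fspan_module oU _)).
apply/sub_dsumr/dsum_module; [exact: Omega_module|exact: (lie_codistr_module oU)].
Qed.

Lemma Omega_sub k k' : (k <= k')%N -> Omega U f g hs h k `<=` Omega U f g hs h k'.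
Proof.
move=> /subnKC <-; elim: (k' - k)%N => [|d IH]; first by rewrite addn0.
by rewrite addnS; apply: subset_trans IH _; exact: OmegaS.
Qed.

Lemma lie_covector_autobracket j :
  eq_field_on U (lie_covector (autobracket_iter g h j f) (nabla h))
    (nabla (lie_fun (autobracket_iter g h j f) h)).
Proof.
apply: lie_covector_nabla => //; exact: is_vector_field_autobracket_iter.
Qed.

(** After [(s + r).+1] steps [Omega] has absorbed all generators of [O_tilde]; from then on both
    recursions apply the same two Lie derivatives. *)
Lemma O_seq_sub_Omega s r k :
  O_seq U f g hs h s r k `<=` Omega U f g hs h ((s + r).+1 + k).
Proof.
elim: k => [|k IH].
  rewrite addn0; apply: dsum_min; first exact: Omega_module.
    apply: bigdsum_min => //; first exact: Omega_module.
    move=> j; rewrite mem_index_iota => /andP[_ jsr].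
    apply: fspan_min; first exact: Omega_module.
    (* The generator of index [j] enters [Omega] at stage [j.+1], and [jsr] says that this is at
       most [(s + r).+1]. *)
    move=> _ ->; apply: (Omega_sub jsr).
    apply: (fmodule_ext (Omega_module _)) => [c q Uq cq|].
      by rewrite -lie_covector_autobracket.
    apply: sub_dsumr; last exact: sub_fspan.
    by do 2 ?apply: dsum_module => //; [exact: Omega_module|..];
      exact: (lie_codistr_module oU).
  exact: (Omega_sub (leq0n _)).
rewrite addnS; apply: dsum_min; first exact: Omega_module.
  apply: dsum_min; first exact: Omega_module.
    exact: subset_trans IH (@OmegaS _).
  exact: subset_trans (lie_codistrS oU IH) (@Omega_lie_f _).
exact: subset_trans (lie_codistrS oU IH) (@Omega_lie_ghat _).
Qed.

(** Being stationary, the codistribution is stable under both Lie derivatives; stability under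
    [ghat] puts the differentials attached to all autobrackets in it, beyond the index [s + r].
    Induction on [k] then applies. *)
Lemma Omega_sub_O_seq s r K k :
  (0 < s)%N -> Omega_g U g h s = Omega_g U g h s.-1 ->
  Delta U f g h r.+1 = Delta U f g h r ->
  O_seq U f g hs h s r K.+1 = O_seq U f g hs h s r K ->
  Omega U f g hs h k `<=` O_seq U f g hs h s r K.
Proof.
move=> s0 Es Er EK.
have mO := O_seq_module s r K.
have Of : lie_codistr U f (O_seq U f g hs h s r K) `<=` O_seq U f g hs h s r K.
  by rewrite -{2}EK; exact: O_seq_lie_f.
have Oghat : lie_codistr U (ghat g h) (O_seq U f g hs h s r K) `<=`
    O_seq U f g hs h s r K.
  by rewrite -{2}EK; exact: O_seq_lie_ghat.
have Oh : forall j,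
    O_seq U f g hs h s r K (nabla (lie_fun (autobracket_iter g h j f) h)).
  apply: (nabla_lie_pair_mem mO Oghat s0 Es Er) => j jsr.
  apply: O_seq0_sub; apply: sub_dsuml; first exact: (fspan_module oU).
  apply: (sub_bigdsum oU (x := j)).
  - by move=> e; exact: (fspan_module oU).
  - by rewrite mem_index_iota.
  - exact: sub_fspan.
elim: k => [|k IH] /=.
  apply: subset_trans (@O_seq0_sub _ _ _).
  by apply: sub_dsumr; apply: (bigdsum_module oU) => e; exact: (fspan_module oU).
apply: dsum_min => //; first apply: dsum_min => //; first apply: dsum_min => //.
- exact: subset_trans (lie_codistrS oU IH) Of.
- exact: subset_trans (lie_codistrS oU IH) Oghat.
- apply: fspan_min => // _ ->.
  by apply: (fmodule_ext mO) (Oh k); exact: lie_covector_autobracket.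
Qed.

End System.

Unset Implicit Arguments.
Set Strict Implicit.

Theorem theorem3p1 (R : realType) (n : nat) (M : smooth_manifold R n)
    (f g : tfield M) (p : nat) (hs : 'I_p -> M -> R) (i0 : 'I_p)
    (U : set M) (s r K : nat)
    (f_smooth : is_vector_field setT f)
    (g_smooth : is_vector_field setT g)
    (hs_smooth : forall j, smooth_fun setT (hs j))
    (U_open : open U)
    (U_nonempty : U !=set0)
    (canonical_form : forall q, U q -> lie_fun g (hs i0) q <> 0)
    (s_def : is_s U g (hs i0) s)
    (r_def : is_r U f g (hs i0) r)
    (K_def : is_O_index U f g hs (hs i0) s r K) :
  (exists khat : nat, forall k : nat, (khat <= k)%N ->
     O_seq U f g hs (hs i0) s r K `<=` Omega U f g hs (hs i0) k) /\
  (forall k : nat,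
     Omega U f g hs (hs i0) k `<=` O_seq U f g hs (hs i0) s r K).
Proof.
have vf : is_vector_field U f by exact: is_vector_field_sub f_smooth.
have vg : is_vector_field U g by exact: is_vector_field_sub g_smooth.
have sh : smooth_fun U (hs i0).
  by move=> c; have := hs_smooth i0 c; exact: smooth_in_sub.
have L0 q : U q -> lie_fun g (hs i0) q != 0 by move=> /canonical_form/eqP.
have [[s0 Es] _] := s_def; have [Er _] := r_def; have [[K0 EK] _] := K_def.
split.
  (* The first summand collects the generators of [O_tilde], the second follows the recursion up to
     its last stage. *)
  exists ((s + r).+1 + K)%N => k Kk.
  by move=> w Ow; apply: (Omega_sub U_open Kk); exact: O_seq_sub_Omega Ow.
(* Stationarity is known between [K.-1] and [K], so the lemma is applied at [K.-1], a true
   predecessor because [K] is positive. *)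
move=> k; rewrite EK; apply: Omega_sub_O_seq => //.
by rewrite prednK.
Qed.
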